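(* Let $\mathcal{F}$ be a saturated fusion system on a finite $2$-group $S$. Suppose that there is a subgroup $D$ of $S$ with $1 < D < S$ such that every subgroup of $S$ with order $|D|$ is abelian and weakly $\mathcal{F}$-closed. If $S$ is nonabelian, suppose moreover that every subgroup of $S$ with order $2|D|$ is abelian and weakly $\mathcal{F}$-closed. Then $\mathcal{F}$ is supersolvable.
   Context: Let $p$ be a prime and $S$ a finite $p$-group. A fusion system $\mathcal{F}$ on $S$ is a category whose objects are the subgroups of $S$ and whose morphism sets $\mathrm{Hom}_{\mathcal{F}}(P,Q)$ consist of injective group homomorphisms $P \to Q$ (with usual composition), contain all homomorphisms $P \to Q$ induced by conjugation by elements of $S$, and are such that each $\varphi \in \mathrm{Hom}_{\mathcal{F}}(P,Q)$ factors as an $\mathcal{F}$-isomorphism $P \to \varphi(P)$ followed by an inclusion. Subgroups $P,Q$ are $\mathcal{F}$-conjugate if they are isomorphic in $\mathcal{F}$. $\mathcal{F}$ is saturated if every subgroup of $S$ is $\mathcal{F}$-conjugate to a subgroup $Q$ that is fully automized ($\mathrm{Aut}_S(Q) \in \mathrm{Syl}_p(\mathrm{Aut}_{\mathcal{F}}(Q))$) and receptive (each $\mathcal{F}$-isomorphism $\varphi : P \to Q$ with $P \le S$ extends to an $\mathcal{F}$-morphism $N_\varphi \to S$, where $N_\varphi = \{ g \in N_S(P) : \varphi c_g \varphi^{-1} \in \mathrm{Aut}_S(Q)\}$). A subgroup $Q \le S$ is weakly $\mathcal{F}$-closed if $\varphi(Q) = Q$ for all $\varphi \in \mathrm{Hom}_{\mathcal{F}}(Q,S)$;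 it is strongly $\mathcal{F}$-closed if for every $P \le Q$ and $\varphi \in \mathrm{Hom}_{\mathcal{F}}(P,S)$ one has $\varphi(P) \le Q$. A saturated fusion system $\mathcal{F}$ on $S$ is supersolvable if there is a series $1 = S_0 \le S_1 \le \dots \le S_m = S$ of subgroups of $S$ such that $S_i$ is strongly $\mathcal{F}$-closed for all $0 \le i \le m$ and $S_{i+1}/S_i$ is cyclic for all $0 \le i < m$. *)

(* Defs.v *)
From mathcomp Require Import all_boot all_fingroup all_solvable.

Set Implicit Arguments.
Unset Strict Implicit.
Unset Printing Implicit Defensive.

Local Open Scope group_scope.

(* Morphisms P -> Q between subgroups of the ambient finite group are given by
   total functions on the carrier, of which only the values on P matter. *)

Definition hom_iso (gT : finGroupType)
    (hom : {group gT} -> {group gT} -> pred (gT -> gT))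
    (P Q : {group gT}) (f : gT -> gT) : Prop :=
  hom P Q f /\
  exists g : gT -> gT, [/\ hom Q P g, {in P, cancel f g} & {in Q, cancel g f}].

(* Identities and inclusions are the maps induced by conjugation by 1. In
   fs_factor, R ranges over the unique group with underlying set f(P); by fs_ext
   the first factor of f, corestricted to f(P), is represented by f itself. *)
Record fusion_system (gT : finGroupType) (S : {group gT}) := FusionSystem {
  fs_hom : {group gT} -> {group gT} -> pred (gT -> gT);
  fs_obj : forall (P Q : {group gT}) f,
    fs_hom P Q f -> P \subset S /\ Q \subset S;
  fs_ext : forall (P Q : {group gT}) f g,
    {in P, f =1 g} -> fs_hom P Q f -> fs_hom P Q g;
  fs_mor : forall (P Q : {group gT}) f, fs_hom P Q f ->
    [/\ {in P &, {morph f : x y / x * y}}, {in P &, injective f}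
      & f @: P \subset Q];
  fs_conj : forall (P Q : {group gT}) x,
    P \subset S -> Q \subset S -> x \in S -> P :^ x \subset Q ->
    fs_hom P Q (conjg^~ x);
  fs_comp : forall (P Q R : {group gT}) f g,
    fs_hom P Q f -> fs_hom Q R g -> fs_hom P R (g \o f);
  fs_factor : forall (P Q R : {group gT}) f,
    fs_hom P Q f -> R :=: f @: P -> hom_iso fs_hom P R f
}.

Section FusionSystem.

Variables (gT : finGroupType) (S : {group gT}) (F : fusion_system S).
Implicit Types (P Q : {group gT}) (f : gT -> gT).

Definition fs_iso P Q f : Prop := hom_iso (fs_hom F) P Q f.

Definition fs_conjugate P Q : Prop := exists f, fs_iso P Q f.

Definition Aut_fs Q : {set {perm gT}} := [set a in Aut Q | fs_hom F Q Q a].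

Definition Aut_S Q : {group {perm gT}} := (conj_aut Q @* 'N_S(Q))%G.

Definition fully_automized (p : nat) Q : Prop := p.-Sylow(Aut_fs Q) (Aut_S Q).

(* f c_g f^-1 is the map sending f x to f (x ^ g) for x in P. With
   x ^ g = g^-1 * x * g, c_g here stands for its inverse; the set is the same. *)
Definition N_ext P Q f : {set gT} :=
  [set g in 'N_S(P) |
    [exists a in Aut_S Q, [forall x in P, f (x ^ g) == a (f x)]]].

Lemma N_ext_group_set P Q f : group_set (N_ext P Q f).
Proof.
apply/group_setP; split=> [|g h].
  rewrite inE group1; apply/exists_inP; exists 1 => //.
  by apply/forall_inP=> x _; rewrite conjg1 perm1.
rewrite [g \in _]inE [h \in _]inE [g * h \in _]inE.
case/andP=> Ng /exists_inP[a Aa /forall_inP fa].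
case/andP=> Nh /exists_inP[b Ab /forall_inP fb].
rewrite groupM //=; apply/exists_inP; exists (a * b); first exact: groupM.
have NPg : g \in 'N(P) by case/setIP: Ng.
apply/forall_inP=> x Px; rewrite conjgM permM.
by rewrite (eqP (fb _ _)) ?memJ_norm // (eqP (fa _ Px)).
Qed.

Canonical N_ext_group P Q f := Group (N_ext_group_set P Q f).

Definition receptive Q : Prop :=
  forall P f, P \subset S -> fs_iso P Q f ->
  exists2 h, fs_hom F (N_ext_group P Q f) S h & {in P, h =1 f}.

Definition saturated (p : nat) : Prop :=
  forall P, P \subset S ->
  exists Q, [/\ Q \subset S, fs_conjugate P Q, fully_automized p Q
              & receptive Q].

Definition weakly_closed Q : Prop :=
  Q \subset S /\ forall f, fs_hom F Q S f -> f @: Q = Q.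

Definition strongly_closed Q : Prop :=
  Q \subset S /\
  forall P f, P \subset Q -> fs_hom F P S f -> f @: P \subset Q.

Definition supersolvable : Prop :=
  exists (m : nat) (s : nat -> {group gT}),
    [/\ s 0%N :=: 1, s m :=: S,
        forall i, i < m -> s i \subset s i.+1,
        forall i, i <= m -> strongly_closed (s i)
      & forall i, i < m -> cyclic (s i.+1 / s i)].

Lemma Aut_fs_group_set Q : Q \subset S -> group_set (Aut_fs Q).
Proof.
move=> sQS; apply/group_setP; split=> [|a b].
  rewrite inE group1; have := @fs_conj _ _ F Q Q 1 sQS sQS (group1 S).
  rewrite conjsg1 => /(_ (subxx _)); apply: fs_ext => x _.
  by rewrite perm1 conjg1.
rewrite [a \in _]inE [b \in _]inE [a * b \in _]inE.
case/andP=> Aa Fa /andP[Ab Fb]; rewrite groupM //=.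
by apply: fs_ext (fs_comp Fa Fb) => x _; rewrite permM.
Qed.

End FusionSystem.

(* Main.v *)
Require Import Defs.
From mathcomp Require Import all_boot all_fingroup all_solvable.

Set Implicit Arguments.
Unset Strict Implicit.
Unset Printing Implicit Defensive.

Local Open Scope group_scope.

(* Write |D| = 2 ^ k. The point is that F is the fusion system of S, so that
   any chain of normal subgroups of S with factors of order 2 is a series of
   strongly closed subgroups. By Frobenius' criterion it suffices that Aut_F(Q)
   is a 2-group whenever 'C_S(Q) is contained in Q. Such a Q has order at least
   2 ^ k.+1, since otherwise it lies properly in an abelian subgroup of that
   order. An automorphism a of odd prime order in Aut_F(Q) stabilises every
   subgroup A of Q of order 2 ^ k.+1 (in the abelian case: every noncyclic one)
   and every maximal subgroup of A, so it fixes A pointwise by an orbit count.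
   Hence a fixes all elements of order at most 4 (in the abelian case: at most
   2), which forces a = 1. *)

(** * Automorphisms of odd order of 2-groups *)

Section PGroupAutomorphisms.

Variable gT : finGroupType.
Implicit Types (P H A M : {group gT}) (a : {perm gT}).

(** Descend from [P] through maximal subgroups containing [H]; each step divides the order by
    [p]. *)
Lemma pgroup_subgroup_above (p j : nat) P H :
  p.-group P -> H \subset P -> #|H| <= p ^ j <= #|P| ->
  exists K : {group gT}, [/\ H \subset K, K \subset P & #|K| = (p ^ j)%N].
Proof.
have [n] := ubnP #|P|; elim: n => // n IHn in P * => ltPn pP sHP /andP[leHj].
rewrite leq_eqVlt => /predU1P[-> | ltjP]; first by exists P.
have [defH | [M maxM sHM]] := maximal_exists sHP.
  by rewrite -defH ltnNge leHj in ltjP.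
have sMP := maxgroupp maxM; have pM := pgroupS (proper_sub sMP) pP.
have leM : p ^ j <= #|M|.
  have oP : #|P| = (#|M| * p)%N.
    by rewrite -(p_maximal_index pP maxM) Lagrange ?proper_sub.
  have [m oM] := p_natP pM.
  (* The strict inequality [p ^ j < p ^ m.+1] rules out [p = 0] and [p = 1]. *)
  move: ltjP; rewrite oP oM -expnSr; case: (p) => [|[|r]].
  - by rewrite [(0 ^ m.+1)%N]exp0n.
  - by rewrite !exp1n.
  by rewrite ltn_exp2l // ltnS leq_exp2l.
have ltM : #|M| < n by rewrite -ltnS (leq_trans _ ltPn) // ltnS proper_card.
have [K [sHK sKM oK]] := IHn M ltM pM sHM (introT andP (conj leHj leM)).
by exists K; split=> //; apply: subset_trans sKM (proper_sub sMP).
Qed.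

Lemma maximal_card2 (k : nat) A M :
  2.-group A -> maximal M A -> #|A| = (2 ^ k.+1)%N -> #|M| = (2 ^ k)%N.
Proof.
move=> pA maxM oA; apply/eqP; rewrite -(eqn_pmul2r (isT : 0 < 2)).
rewrite -[in X in X == _](p_maximal_index pA maxM) Lagrange ?oA ?expnSr //.
exact: proper_sub (maxgroupp maxM).
Qed.

Lemma odd_prime_p'elt (q : nat) a : prime q -> odd q -> #[a] = q -> 2^'.-elt a.
Proof.
move=> q_pr q_odd oa; rewrite /p_elt oa pnatE // inE /= inE.
by apply: contraTneq q_odd => ->.
Qed.

Lemma Aut1 P a : a \in Aut P -> a 1 = 1.
Proof. by move=> Aa; rewrite -(autmE Aa) morph1. Qed.

Lemma AutM P a : a \in Aut P -> {in P &, {morph a : x y / x * y}}.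
Proof. by move=> Aa x y Px Py; rewrite -(autmE Aa) morphM. Qed.

Lemma AutX P a n : a \in Aut P -> {in P, {morph a : x / x ^+ n}}.
Proof. by move=> Aa x Px; rewrite -(autmE Aa) morphX. Qed.

(* With [y := x^-1 * a x], [(a ^+ n) x = x * y ^+ n]; take [n = #[a]]. *)
Lemma Aut_fix_quotient (p : nat) P a x :
  p.-group P -> a \in Aut P -> p^'.-elt a -> x \in P ->
  a (x^-1 * a x) = x^-1 * a x -> a x = x.
Proof.
move=> pP Aa p'a Px; set y := x^-1 * a x => ay.
have Py : y \in P by rewrite groupM ?groupV // (Aut_closed Aa).
have ax : a x = x * y by rewrite mulKVg.
move: (y) ay Py ax => {}y ay Py ax.
have aX n : (a ^+ n) x = x * y ^+ n.
  elim: n => [|n IHn]; first by rewrite perm1 mulg1.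
  rewrite expgSr permM IHn (AutM Aa) ?groupX // (AutX n Aa) // ay ax.
  by rewrite expgS -mulgA.
have y_a : y ^+ #[a] = 1.
  by apply: (mulgI x); rewrite -aX expg_order perm1 mulg1.
have : #[y] == 1%N.
  rewrite -dvdn1; rewrite -(eqP (pnat_coprime (mem_p_elt pP Py) p'a)).
  by rewrite dvdn_gcd dvdnn order_dvdn y_a eqxx.
by rewrite order_eq1 ax => /eqP->; rewrite mulg1.
Qed.

(** Induction on the exponent of [x]: once [a] fixes [x ^+ p], commutativity gives [x^-1 * a x]
    trivial [p]-th power, so [a] fixes this quotient and hence [x]. *)
Lemma Aut_fix_abelian (p : nat) P A a :
  p.-group P -> a \in Aut P -> p^'.-elt a ->
  A \subset P -> abelian A -> {in A, forall x, a x \in A} ->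
  {in A, forall x, x ^+ p = 1 -> a x = x} -> {in A, a =1 id}.
Proof.
move=> pP Aa p'a sAP abA aA fix_p x Ax.
have pA := pgroupS sAP pP.
have [n ox] : exists n, x ^+ (p ^ n) = 1.
  by have [n oA] := p_natP pA; exists n; rewrite -oA expg_cardG.
elim: n x Ax ox => [|n IHn] x Ax; first by rewrite expg1 => ->; apply: Aut1 Aa.
rewrite expnS expgM => ox.
have Px := subsetP sAP x Ax.
have axp : a x ^+ p = x ^+ p by rewrite -(AutX p Aa) // IHn ?groupX.
apply: (Aut_fix_quotient pP Aa p'a Px); apply: fix_p.
  by rewrite groupM ?groupV ?aA.
rewrite expgMn; last by apply: (centsP abA); rewrite ?groupV ?aA.
by rewrite axp expgVn mulVg.
Qed.

(** Automorphisms centralising a Thompson critical subgroup [K] form a 2-group, so it suffices that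
    [a] fixes first ['Z(K)], then [K], pointwise. *)
Lemma Aut_fix_exponent4 P a :
  2.-group P -> a \in Aut P -> 2^'.-elt a ->
  {in P, forall x, x ^+ 4 = 1 -> a x = x} -> a = 1.
Proof.
move=> pP Aa p'a fix4.
have [K critK] := Thompson_critical pP; have [chK sPhiZ _ _] := critK.
have sKP := char_sub chK; have pK := pgroupS sKP pP.
have aK : {in K, forall x, a x \in K}.
  move=> x Kx; have /charP[_ /(_ _ (injm_autm Aa) (im_autm Aa)) <-] := chK.
  by rewrite -{1}(autmE Aa) mem_morphim ?(subsetP sKP).
have aZ : {in 'Z(K), forall x, a x \in 'Z(K)}.
  have chZ := char_trans (center_char K) chK.
  move=> x Kx; have /charP[_ /(_ _ (injm_autm Aa) (im_autm Aa)) <-] := chZ.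
  by rewrite -{1}(autmE Aa) mem_morphim ?(subsetP (char_sub chZ)).
have fixZ : {in 'Z(K), a =1 id}.
  apply: (@Aut_fix_abelian 2 P 'Z(K)%G a pP Aa p'a) => //.
  - exact: subset_trans (center_sub K) sKP.
  - exact: center_abelian.
  move=> x /setIP[Kx _] x2; apply: fix4; first exact: (subsetP sKP).
  by rewrite (expgM x 2 2) x2 expg1n.
move: sPhiZ; rewrite (Phi_joing pK) join_subG => /andP[sK'Z sMhoZ].
have Z2 x : x \in K -> x ^+ 2 \in 'Z(K).
  by move=> Kx; apply: (subsetP sMhoZ); rewrite (Mho_p_elt 1) // (mem_p_elt pK).
have cZ x y : x \in 'Z(K) -> y \in K -> commute y x.
  by case/setIP=> _ /centP cx Ky; apply/commute_sym/cx.
have fixK : {in K, a =1 id}.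
  move=> x Kx; have Px := subsetP sKP x Kx; have Kax := aK x Kx.
  apply: (Aut_fix_quotient pP Aa p'a Px); apply: fix4.
    by rewrite groupM ?groupV // (subsetP sKP).
  have ax2 : a x ^+ 2 = x ^+ 2 by rewrite -(AutX 2 Aa) // fixZ ?Z2.
  (* As [K] has class at most 2 and [a] fixes [x ^+ 2], the square of [x^-1 * a x] is the central
     [c], and [c ^+ 2 = [~ x ^+ 2, x^-1] = 1]. *)
  set c := [~ a x, x^-1].
  have Zc : c \in 'Z(K) by rewrite (subsetP sK'Z) // mem_commg ?groupV.
  have y2 : (x^-1 * a x) ^+ 2 = c.
    rewrite expMg_Rmul; try by apply: cZ; rewrite ?groupV.
    by rewrite ax2 expgVn mulVg mul1g.
  rewrite (expgM _ 2 2) y2 -commXg; last exact: cZ.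
  by rewrite ax2; apply/eqP/commgP/commuteV/commute_sym/commuteX.
have Ca : a \in 'C(K | [Aut P]).
  rewrite 2!inE Aa; apply/subsetP=> x Kx.
  by rewrite inE; apply/eqP/fixK.
have pa : 2.-elt a := mem_p_elt (critical_p_stab_Aut critK pP) Ca.
apply/eqP; rewrite -order_eq1 -dvdn1.
by rewrite -(eqP (pnat_coprime pa p'a)) dvdn_gcd dvdnn.
Qed.

(* If not, a maximal subgroup [M] contains the fixed points of [a] in [A],
   but [a] has a fixed point in [A :\: M], a set of 2-power order. *)
Lemma Aut_fix_of_maximal (q : nat) P A a :
  2.-group P -> a \in Aut P -> prime q -> odd q -> #[a] = q ->
  A \subset P -> a @: A = A ->
  (forall M, maximal M A -> a @: M = M) -> {in A, a =1 id}.
Proof.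
move=> pP Aa q_pr q_odd oa sAP aA aM.
have gC : group_set [set x in A | a x == x].
  apply/group_setP; split=> [|x y]; first by rewrite inE group1 (Aut1 Aa) eqxx.
  rewrite !inE => /andP[Ax /eqP ax] /andP[Ay /eqP ay].
  by rewrite groupM // (AutM Aa) ?(subsetP sAP) // ax ay eqxx.
pose C := Group gC.
have sCA : C \subset A by apply/subsetP=> x /setIdP[].
have [eqCA x | [M maxM sCM] x Ax] := maximal_exists sCA.
  by rewrite -eqCA => /setIdP[_ /eqP].
have pA := pgroupS sAP pP; have sMA := proper_sub (maxgroupp maxM).
have memE (B : {set gT}) y : a @: B = B -> (a y \in B) = (y \in B).
  by move=> aB; rewrite -{1}aB mem_imset //; apply: perm_inj.
have actsB : [acts <[a]>, on A :\: M | 'P].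
  rewrite cycle_subG; apply/astabsP=> y /=.
  by rewrite !inE /aperm (memE M) ?(memE A) // aM.
have q_a : q.-group <[a]> by rewrite /pgroup -orderE oa pnat_id.
have oB : #|A :\: M| = #|M|.
  rewrite cardsDS // -(Lagrange sMA) (p_maximal_index pA maxM).
  by rewrite muln2 -addnn addnK.
have := pgroup_fix_mod q_a actsB; rewrite oB.
have [n ->] := p_natP (pgroupS sMA pA).
have [-> | [y]] := set_0Vmem 'Fix_(A :\: M | 'P)(<[a]>).
  rewrite cards0 mod0n => /eqP; rewrite -/(q %| _) Euclid_dvdX //.
  case/andP=> /dvdn_leq q_le2 _; have := prime_gt1 q_pr.
  by case: q q_odd q_le2 {q_pr oa q_a} => [|[|[|q]]] // _ /(_ isT).
case/setIP=> /setDP[Ay notMy] /afixP/(_ a (cycle_id a)) /= fix_y _.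
case/negP: notMy; rewrite (subsetP sCM) // inE Ay; exact/eqP.
Qed.

(** * Automorphisms preserving all subgroups of order [2 ^ k] *)

Lemma Aut_fix_of_index2 (q k : nat) P A a :
  2.-group P -> a \in Aut P -> prime q -> odd q -> #[a] = q ->
  (forall M, M \subset P -> #|M| = (2 ^ k)%N -> a @: M = M) ->
  A \subset P -> #|A| = (2 ^ k.+1)%N -> a @: A = A -> {in A, a =1 id}.
Proof.
move=> pP Aa q_pr q_odd oa aM sAP oA aA.
apply: (Aut_fix_of_maximal pP Aa q_pr q_odd oa sAP aA) => M maxM.
have sMA := proper_sub (maxgroupp maxM).
apply: aM; first exact: subset_trans sMA sAP.
exact: maximal_card2 (pgroupS sAP pP) maxM oA.
Qed.

Lemma Aut_rigid_abelian (q k : nat) P a :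
  2.-group P -> a \in Aut P -> prime q -> odd q -> #[a] = q ->
  abelian P -> 0 < k -> 2 ^ k.+1 <= #|P| ->
  (forall M, M \subset P -> #|M| = (2 ^ k)%N -> a @: M = M) -> a = 1.
Proof.
move=> pP Aa q_pr q_odd oa abP k_gt0 lePk aM.
have p'a := odd_prime_p'elt q_pr q_odd oa.
suffices fix2 : {in P, forall x, x ^+ 2 = 1 -> a x = x}.
  apply: (eq_Aut Aa (group1 _)) => x Px; rewrite perm1.
  by apply: (Aut_fix_abelian pP Aa p'a) fix2 _ Px => // y; apply: Aut_closed.
move=> x Px x2; have [-> | ntx] := eqVneq x 1; first exact: Aut1 Aa.
have ox : #[x] = 2 by apply: nt_prime_order.
have sxP : <[x]> \subset P by rewrite cycle_subG.
have [|A [sxA sAP oA]] := @pgroup_subgroup_above 2 k.+1 P <[x]>%G pP sxP.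
  by rewrite lePk andbT -orderE ox -{1}(expn1 2) leq_exp2l.
have Ax : x \in A by rewrite -cycle_subG.
have pA := pgroupS sAP pP.
have [eqA1 | [M maxM _]] := maximal_exists (sub1G A).
  by have := @ltn_exp2l 2 0 k.+1 isT; rewrite -oA -eqA1 cards1.
have [sMA notsAM] := andP (maxgroupp maxM).
have oM := maximal_card2 pA maxM oA.
have invM := aM M (subset_trans sMA sAP) oM.
have [g Ag notMg] := subsetPn notsAM.
have sgA : <[g]> \subset A by rewrite cycle_subG.
have [defA | [M2 maxM2 sgM2]] := maximal_exists sgA.
  (* If [A] is cyclic, [M] contains [x] because [0 < k], hence also [a x]; but [A] has only one
     subgroup of order 2. *)
  have cycA : cyclic A by rewrite -defA cycle_cyclic.
  have Mx : x \in M.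
    rewrite -cycle_subG -(cardSg_cyclic cycA) // oM -orderE ox.
    by rewrite -{1}(expn1 2) dvdn_exp2l.
  have Max : a x \in M by rewrite -invM imset_f.
  have : a x \in <[x]>.
    rewrite -cycle_subG -(cardSg_cyclic cycA) ?cycle_subG ?(subsetP sMA) //.
    by rewrite -!orderE ox order_dvdn -(AutX 2 Aa) // x2 (Aut1 Aa).
  rewrite cycle2g // !inE => /orP[/eqP ax1 | /eqP//].
  by case/eqP: ntx; apply: (@perm_inj _ a); rewrite ax1 (Aut1 Aa).
(* Otherwise the distinct maximal subgroups [M] and [M2] generate [A]; both are preserved by [a],
   hence so is [A]. *)
have sM2A := proper_sub (maxgroupp maxM2).
have oM2 := maximal_card2 pA maxM2 oA.
have invM2 := aM M2 (subset_trans sM2A sAP) oM2.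
have defA : M <*> M2 = A.
  apply/eqP; rewrite eqEproper join_subG sMA sM2A /=; apply/negP=> prMM2.
  have [_ /(_ (M <*> M2)%G prMM2 (joing_subl _ _)) eqM] := maxgroupP maxM.
  case/negP: notMg; rewrite -eqM (subsetP (joing_subr _ _)) //.
  by rewrite -cycle_subG.
have imE (B : {set gT}) : B \subset P -> a @: B = autm Aa @* B.
  by move=> sBP; rewrite morphimEsub.
have invA : a @: A = A.
  rewrite imE // -{1}defA morphimY ?(subset_trans sMA) ?(subset_trans sM2A) //.
  by rewrite -!imE ?(subset_trans sMA) ?(subset_trans sM2A) // invM invM2.
exact: (Aut_fix_of_index2 pP Aa q_pr q_odd oa aM sAP oA invA).
Qed.

Lemma Aut_rigid (q k : nat) P a :
  2.-group P -> a \in Aut P -> prime q -> odd q -> #[a] = q ->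
  0 < k -> 2 ^ k.+1 <= #|P| ->
  (forall M, M \subset P -> #|M| = (2 ^ k)%N -> a @: M = M) ->
  (forall A, A \subset P -> #|A| = (2 ^ k.+1)%N -> a @: A = A) -> a = 1.
Proof.
move=> pP Aa q_pr q_odd oa k_gt0 lePk aM aA.
have p'a := odd_prime_p'elt q_pr q_odd oa.
apply: (Aut_fix_exponent4 pP Aa p'a) => x Px x4.
have sxP : <[x]> \subset P by rewrite cycle_subG.
have [|A [sxA sAP oA]] := @pgroup_subgroup_above 2 k.+1 P <[x]>%G pP sxP.
  (* Since [0 < k], the order of [x] is at most [4 <= 2 ^ k.+1]. *)
  rewrite lePk andbT -orderE (@leq_trans (2 ^ 2)) // ?leq_exp2l //.
  by rewrite dvdn_leq // order_dvdn x4.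
apply: (Aut_fix_of_index2 pP Aa q_pr q_odd oa aM sAP oA (aA A sAP oA)).
by rewrite -cycle_subG.
Qed.

End PGroupAutomorphisms.

(** * Elementary operations on morphisms of a fusion system *)

Section Fusion.

Variables (gT : finGroupType) (S : {group gT}) (F : fusion_system S).
Implicit Types (P Q R : {group gT}) (f : gT -> gT).

Lemma fs_hom_restrict P Q R f :
  fs_hom F P Q f -> R \subset P -> fs_hom F R Q f.
Proof.
move=> homf sRP; have [sPS _] := fs_obj homf.
have homi : fs_hom F R P (conjg^~ 1).
  by apply: fs_conj; rewrite ?conjsg1 ?group1 // (subset_trans sRP).
by apply: fs_ext (fs_comp homi homf) => x _ /=; rewrite conjg1.
Qed.

Lemma fs_hom_widen P Q R f :
  fs_hom F P Q f -> Q \subset R -> R \subset S -> fs_hom F P R f.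
Proof.
move=> homf sQR sRS; have [_ sQS] := fs_obj homf.
have homi : fs_hom F Q R (conjg^~ 1).
  by apply: fs_conj; rewrite ?conjsg1 ?group1.
by apply: fs_ext (fs_comp homf homi) => x _ /=; rewrite conjg1.
Qed.

Lemma fs_iso_im P Q f : fs_iso F P Q f -> f @: P = Q.
Proof.
case=> /fs_mor[_ _ sfP] [g [/fs_mor[_ _ sgQ] fK gK]].
apply/eqP; rewrite eqEsubset sfP; apply/subsetP=> y Qy; rewrite -(gK y Qy).
by rewrite imset_f // (subsetP sgQ) ?imset_f.
Qed.

Lemma fs_iso_endo Q f : fs_hom F Q Q f -> fs_iso F Q Q f.
Proof.
move=> homf; have [_ injf sfQ] := fs_mor homf.
apply: fs_factor homf _; apply/esym/eqP.
by rewrite eqEcard sfQ (card_in_imset injf) leqnn.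
Qed.

(** Only the values of [f] on [Q] matter; the permutation agreeing with [f] there and fixing
    everything outside [Q] lies in [Aut Q]. *)
Lemma fs_endo_Aut Q f :
  fs_hom F Q Q f -> exists2 a, a \in Aut_fs F Q & {in Q, f =1 a}.
Proof.
move=> homf; have [fM injf _] := fs_mor homf.
pose fm : {morphism Q >-> gT} := Morphism fM.
have injfm : 'injm fm by apply/injmP.
have imfm : fm @* Q = Q by rewrite morphimEdom; apply/fs_iso_im/fs_iso_endo.
have fE : {in Q, f =1 aut injfm imfm} by move=> x Qx; rewrite autE.
by exists (aut injfm imfm); rewrite // inE Aut_aut; apply: fs_ext fE homf.
Qed.

(** Here [a] is the transport of conjugation by [g] along [f]. When [Aut_F(Q) = Aut_S(Q)], this
    places ['N_S(R)] inside [N_ext]. *)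
Lemma fs_iso_conjg Q R f g : fs_iso F R Q f -> g \in 'N_S(R) ->
  exists2 a, a \in Aut_fs F Q & {in R, forall x, f (x ^ g) = a (f x)}.
Proof.
move=> isof /setIP[Sg NRg]; have [homf [f1 [homf1 fK f1K]]] := isof.
have [sRS _] := fs_obj homf.
have homg : fs_hom F R R (conjg^~ g).
  by apply: fs_conj; rewrite // (normP NRg).
have [a Aa aE] := fs_endo_Aut (fs_comp (fs_comp homf1 homg) homf).
exists a => // x Rx; have [_ _ sfR] := fs_mor homf.
by rewrite -aE /= ?fK // (subsetP sfR) ?imset_f.
Qed.

(** * Frobenius' criterion: morphisms induced by conjugation in [S] *)

Definition S_conj P f := exists2 g, g \in S & {in P, f =1 conjg^~ g}.

Lemma S_conj_Aut_S Q a :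
  Q \subset S -> a \in Aut Q -> S_conj Q a -> a \in Aut_S S Q.
Proof.
move=> sQS Aa [g Sg ag].
have NQg : g \in 'N(Q).
  rewrite inE; apply/subsetP=> _ /imsetP[x Qx ->].
  by rewrite -ag // (Aut_closed Aa).
have -> : a = conj_aut Q g.
  apply: (eq_Aut Aa) => [|x Qx]; first exact: Aut_aut.
  by rewrite ag // norm_conj_autE.
by rewrite mem_morphim // inE Sg.
Qed.

Lemma Aut_S_S_conj Q a : a \in Aut_S S Q -> S_conj Q a.
Proof.
case/morphimP=> g NQg /setIP[Sg _] ->; exists g => // x Qx.
exact: norm_conj_autE.
Qed.

(* Downward induction on [P]: a morphism with receptive target [Q] extends to
   the normaliser of its source, as [Aut_F(Q) = Aut_S(Q)]. The latter holds by
   Sylow's theorem if 'C_S(Q) is contained in [Q]; otherwise each element of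
   [Aut_F(Q)] extends to [Q 'C_S(Q)], where the induction hypothesis applies. *)
Lemma centric_Aut_pgroup_S_conj (p : nat) :
  p.-group S -> saturated F p ->
  (forall Q, Q \subset S -> 'C_S(Q) \subset Q -> p.-group (Aut_fs F Q)) ->
  forall P f, fs_hom F P S f -> S_conj P f.
Proof.
move=> pS satF pAut P f.
have [n] := ubnP (#|S| - #|P|); elim: n => // n IHn in P f * => ltPn homf.
have [sPS _] := fs_obj homf.
have [Q [sQS [psi isopsi] fullQ recQ]] := satF P sPS.
have IH R h : #|P| < #|R| -> fs_hom F R S h -> S_conj R h.
  move=> ltPR homh; apply: IHn => //; have [sRS _] := fs_obj homh.
  rewrite -ltnS (leq_trans _ ltPn) // ltnS ltn_sub2l //.
  by rewrite (leq_trans ltPR) ?subset_leq_card.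
have cardQ R h : fs_iso F R Q h -> #|R| = #|Q|.
  move=> isoh; rewrite -(fs_iso_im isoh) card_in_imset //.
  by case: isoh => /fs_mor[].
have AutQ : {subset Aut_fs F Q <= Aut_S S Q}.
  have [cQ | ncQ] := boolP ('C_S(Q) \subset Q).
    have Qp : p.-group (Group (Aut_fs_group_set F sQS)) by apply: pAut.
    move=> a Aa; suffices <- : Aut_fs F Q = Aut_S S Q by [].
    have sylQ : p.-Sylow(Group (Aut_fs_group_set F sQS)) (Aut_S S Q) by [].
    by rewrite -[LHS]/(gval (Group (Aut_fs_group_set F sQS))) (pHall_id sylQ).
  move=> a /setIdP[Aa homa].
  have [h homh ha] := recQ Q a sQS (fs_iso_endo homa).
  (* Conjugation by [g] in [Q] is transported by [a] to conjugation by [a g]; for [g] in ['C_S(Q)]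
     it is transported to the identity. *)
  have sQN : Q \subset N_ext S Q Q a.
    apply/subsetP=> g Qg; have NQg := subsetP (normG Q) g Qg.
    rewrite inE inE (subsetP sQS) //= NQg /=.
    have Qag := Aut_closed Aa Qg.
    apply/exists_inP; exists (conj_aut Q (a g)).
      have NQag := subsetP (normG Q) _ Qag.
      by rewrite mem_morphim // inE (subsetP sQS).
    apply/forall_inP=> x Qx; rewrite conj_autE ?(Aut_closed Aa) //.
    by rewrite -(autmE Aa) morphJ.
  have sCN : 'C_S(Q) \subset N_ext S Q Q a.
    apply/subsetP=> g /setIP[Sg CQg].
    rewrite inE inE Sg (subsetP (cent_sub Q)) //=.
    apply/exists_inP; exists 1; first exact: group1.
    by apply/forall_inP=> x Qx; rewrite conjgE -(centP CQg) // mulKg perm1.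
  have [|g Sg hg] := IH _ _ _ homh.
    rewrite (cardQ _ _ isopsi) proper_card // properE sQN.
    by apply: contra ncQ; apply: subset_trans.
  apply: S_conj_Aut_S => //; exists g => // x Qx.
  by rewrite -ha // hg // (subsetP sQN).
(* This will be applied to [psi] on [P] and to [psi \o f1] on the image of [f], where [f1] inverts
   [f]. *)
have conjQ R h : #|P| = #|R| -> fs_iso F R Q h -> S_conj R h.
  move=> ePR isoh; have [homh _] := isoh; have [sRS _] := fs_obj homh.
  (* For [R = S] there is no larger source, but then [Q = S] and [h] itself lies in [Aut_F(Q)].
     Otherwise normalisers grow in the nilpotent group [S]. *)
  have [eqRS | ltRS] := eqVproper sRS.
    have eqQR : Q = R.
      apply/val_inj/eqP; rewrite /= eqEcard -(cardQ _ _ isoh) eqRS sQS leqnn.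
      by [].
    move: homh; rewrite eqQR => homh.
    have [a Aa hE] := fs_endo_Aut homh.
    have [|g Sg ag] := @Aut_S_S_conj R a.
      by move: (AutQ a); rewrite eqQR; apply.
    by exists g => // x Rx; rewrite hE // ag.
  have [k homk kh] := recQ R h sRS isoh.
  have sNN : 'N_S(R) \subset N_ext S R Q h.
    apply/subsetP=> g Ng; rewrite inE Ng /=.
    have [a Aa ha] := fs_iso_conjg isoh Ng.
    apply/exists_inP; exists a; first exact: AutQ.
    by apply/forall_inP=> x Rx; rewrite ha.
  have ltRN := nilpotent_proper_norm (pgroup_nil pS) ltRS.
  have [|g Sg kg] := IH _ _ _ homk.
    by rewrite ePR (leq_trans (proper_card ltRN)) ?subset_leq_card.
  exists g => // x Rx; rewrite -kh // kg // (subsetP sNN) //.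
  by rewrite (subsetP (proper_sub ltRN)).
have [fM injf sfP] := fs_mor homf.
pose fm : {morphism P >-> gT} := Morphism fM.
have imf : (fm @* P)%G :=: f @: P by rewrite /= morphimEdom.
have [homf' [f1 [homf1 fK f1K]]] := fs_factor homf imf.
have [hompsi [psi1 [hompsi1 psiK psi1K]]] := isopsi.
have isopsif : fs_iso F (fm @* P)%G Q (psi \o f1).
  split; first exact: fs_comp homf1 hompsi.
  exists (f \o psi1); split; first exact: fs_comp hompsi1 homf'.
    move=> x Rx /=; rewrite psiK ?f1K //.
    by have [_ _ sf1] := fs_mor homf1; rewrite (subsetP sf1) ?imset_f.
  move=> y Qy /=; rewrite fK ?psi1K //.
  by have [_ _ sp1] := fs_mor hompsi1; rewrite (subsetP sp1) ?imset_f.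
have [g Sg psig] := conjQ P psi erefl isopsi.
have [|g' Sg' psig'] := conjQ _ _ _ isopsif.
  by rewrite imf card_in_imset.
(* From [psi x = x ^ g] and [psi x = (f x) ^ g']. *)
exists (g * g'^-1); first by rewrite groupM ?groupV.
move=> x Px; rewrite conjgM -psig //.
have Rfx : f x \in (fm @* P)%G by rewrite /= imf imset_f.
by have := psig' _ Rfx; rewrite /= fK // => ->; rewrite conjgK.
Qed.

(** * Series of strongly closed subgroups *)

Lemma S_conj_strongly_closed :
  (forall P f, fs_hom F P S f -> S_conj P f) ->
  forall Q, Q <| S -> strongly_closed F Q.
Proof.
move=> allS Q /andP[sQS nQS]; split=> // P f sPQ homf.
have [g Sg fE] := allS P f homf.
apply/subsetP=> _ /imsetP[x Px ->]; rewrite fE // memJ_norm ?(subsetP sPQ) //.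
exact: (subsetP nQS).
Qed.

(** Induction on the order of [Q]: it contains a subgroup of index [p] normal in [S], whose series
    is extended by [Q]. *)
Lemma pgroup_normal_series (p : nat) Q : prime p -> p.-group S -> Q <| S ->
  exists (m : nat) (s : nat -> {group gT}),
    [/\ s 0%N :=: 1, s m :=: Q,
        forall i, i < m -> s i \subset s i.+1,
        forall i, i <= m -> s i <| S
      & forall i, i < m -> cyclic (s i.+1 / s i)].
Proof.
move=> p_pr pS nsQS; have [n oQ] := p_natP (pgroupS (normal_sub nsQS) pS).
elim: n => [|n IHn] in Q nsQS oQ *.
  have Q1 : Q :=: 1 by apply: card1_trivg.
  by exists 0%N, (fun=> Q); split=> //; rewrite Q1.
have [|R [sRQ nsRS oR]] := @normal_pgroup p _ n _ _ pS nsQS.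
  by rewrite oQ pfactorK.
have [m [s [s0 sm s_sub s_norm s_cyc]]] := IHn R nsRS oR.
have cycQR : cyclic (Q / R).
  apply: prime_cyclic; rewrite card_quotient; last first.
    exact: subset_trans (normal_sub nsQS) (normal_norm nsRS).
  by rewrite -divgS // oQ oR -expnB ?prime_gt0 // subSnn expn1.
exists m.+1, (fun i => if i <= m then s i else Q); split=> // [|i|i|i].
- by rewrite ltnn.
- rewrite ltnS => le_im; rewrite le_im; have [/s_sub //|ge_im] := ltnP i m.
  by have /eqP-> : i == m; [rewrite eqn_leq le_im | rewrite sm].
- by have [/s_norm | ] := leqP i m.
rewrite ltnS => le_im; rewrite le_im; have [/s_cyc //|ge_im] := ltnP i m.
by have /eqP-> : i == m; [rewrite eqn_leq le_im | rewrite sm].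
Qed.

Lemma S_conj_supersolvable (p : nat) : prime p -> p.-group S ->
  (forall P f, fs_hom F P S f -> S_conj P f) -> supersolvable F.
Proof.
move=> p_pr pS allS.
have [m [s [s0 sm s_sub s_norm s_cyc]]] :=
  pgroup_normal_series p_pr pS (normal_refl S).
by exists m, s; split=> // i le_im; apply/S_conj_strongly_closed/s_norm.
Qed.

End Fusion.

(** * Supersolvability from abelian weakly closed subgroups *)

Theorem theorem2 (gT : finGroupType) (S : {group gT}) (F : fusion_system S)
    (S_2group : 2.-group S) (F_sat : saturated F 2)
    (D : {group gT}) (D_nontriv : 1%G \proper D) (D_proper : D \proper S)
    (order_D : forall E : {group gT}, E \subset S -> #|E| = #|D| ->
       abelian E /\ weakly_closed F E)
    (order_2D : ~~ abelian S ->
       forall E : {group gT}, E \subset S -> #|E| = (2 * #|D|)%N ->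
       abelian E /\ weakly_closed F E) :
  supersolvable F.
Proof.
apply: (@S_conj_supersolvable _ _ _ 2) => //.
apply: (centric_Aut_pgroup_S_conj S_2group F_sat) => Q sQS cQ.
have [k oD] := p_natP (pgroupS (proper_sub D_proper) S_2group).
have k_gt0 : 0 < k.
  by have := proper_card D_nontriv; rewrite cards1 oD; case: (k).
have lt_kS : 2 ^ k.+1 <= #|S|.
  have [n oS] := p_natP S_2group.
  by have := proper_card D_proper; rewrite oD oS !(ltn_exp2l, leq_exp2l).
have pQ := pgroupS sQS S_2group.
(* A smaller [Q] would lie in an abelian [E] of order [2 ^ k.+1]; then [E] centralises [Q], so [E]
   is contained in [Q], which is too small. *)
have le_kQ : 2 ^ k.+1 <= #|Q|.
  rewrite leqNgt; apply/negP=> lt_Qk.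
  have [|E [sQE sES oE]] := pgroup_subgroup_above S_2group sQS (j := k.+1).
    by rewrite lt_kS ltnW.
  have abE : abelian E.
    have [abS | nabS] := boolP (abelian S); first exact: abelianS abS.
    by have [] := order_2D nabS E sES; rewrite // oE oD expnS.
  have sEQ : E \subset Q.
    by rewrite (subset_trans _ cQ) // subsetI sES (centsS sQE).
  by move: lt_Qk; rewrite -oE ltnNge subset_leq_card.
have inv a (A : {group gT}) :
  a \in Aut_fs F Q -> A \subset Q -> weakly_closed F A -> a @: A = A.
  move=> /setIdP[_ homa] sAQ [_]; apply.
  exact: fs_hom_widen (fs_hom_restrict homa sAQ) sQS (subxx S).
(* An odd prime divisor of the order of [Aut_F(Q)] would give, by Cauchy, an element [a] of that
   order, which rigidity forces to be trivial. *)
apply/(@pgroupP _ _ (Group (Aut_fs_group_set F sQS))) => q q_pr.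
case/(Cauchy q_pr) => a Aa oa; apply/negPn/negP => /= q_neq2.
have q_odd : odd q by case: (even_prime q_pr) q_neq2 => // ->.
have AutQa : a \in Aut Q by case/setIdP: Aa.
have aM (M : {group gT}) : M \subset Q -> #|M| = (2 ^ k)%N -> a @: M = M.
  move=> sMQ oM; apply: inv => //.
  by have [] := order_D M (subset_trans sMQ sQS); rewrite // oM oD.
suffices a1 : a = 1 by move: q_pr; rewrite -oa a1 order1.
have [abS | nabS] := boolP (abelian S).
  have abQ := abelianS sQS abS.
  exact: Aut_rigid_abelian pQ AutQa q_pr q_odd oa abQ k_gt0 le_kQ aM.
apply: Aut_rigid pQ AutQa q_pr q_odd oa k_gt0 le_kQ aM _ => A sAQ oA.
apply: inv => //.
by have [] := order_2D nabS A (subset_trans sAQ sQS); rewrite // oA oD expnS.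
Qed.
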